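(* Let $\mathbf A$ be an implicator groupoid. Then: (a) the following identities hold in $\mathbf{A}$: (1) $(x \lor y)' \approx x' \land y'$; (2) $(x \land y)' \approx x' \lor y'$. (b) The following are equivalent in $\mathbf{A^{mj}}$: (1) $x \land y \approx y \land x$; (2) $x \lor y \approx y \lor x$. (c) The following are equivalent in $\mathbf{A^{mj}}$: (1) $x \land (y \lor z) \approx (x \land y) \lor (x \land z)$; (2) $x \lor (y \land z) \approx (x \lor y) \land (x \lor z)$.
   Context: An implicator groupoid is an algebra $\mathbf A = \langle A, \to, 0 \rangle$, with $\to$ binary and $0$ a constant, which, writing $x' := x \to 0$, satisfies the identities (I) $(x \to y) \to z \approx [(z' \to x) \to (y \to z)']'$ and (I$_0$) $0'' \approx 0$. Put $x \land y := (x \to y')'$ and $x \lor y := (x' \land y')'$, and let $\mathbf{A^{mj}} := \langle A, \land, \lor, 0 \rangle$. *)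

(* Defs.v *)
Set Implicit Arguments.
Unset Strict Implicit.
Unset Printing Implicit Defensive.

Declare Scope ig_scope.
Delimit Scope ig_scope with ig.
Declare Scope mj_scope.
Delimit Scope mj_scope with mj.

(* In [ig_I], the prime of the source is written out, z' being z -> 0, because
   it is only introduced as a notation below. *)
Record ImplicatorGroupoid : Type := MkImplicatorGroupoid {
  ig_carrier :> Type;
  ig_imp : ig_carrier -> ig_carrier -> ig_carrier;
  ig_zero : ig_carrier;
  ig_I : forall x y z : ig_carrier,
    ig_imp (ig_imp x y) z =
    ig_imp (ig_imp (ig_imp (ig_imp z ig_zero) x)
                   (ig_imp (ig_imp y z) ig_zero)) ig_zero;
  ig_I0 : ig_imp (ig_imp ig_zero ig_zero) ig_zero = ig_zero
}.

Arguments ig_zero {_}.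

Definition ig_neg (A : ImplicatorGroupoid) (x : A) : A := ig_imp x ig_zero.

Notation "x ~> y" := (ig_imp x y) (at level 55, right associativity) : ig_scope.
Notation "x ^'" := (ig_neg x) (at level 2, left associativity, format "x ^'")
  : ig_scope.

Definition ig_meet (A : ImplicatorGroupoid) (x y : A) : A := ((x ~> y^')^')%ig.

Notation "x ∧ y" := (ig_meet x y) (at level 40, left associativity) : ig_scope.

Definition ig_join (A : ImplicatorGroupoid) (x y : A) : A := ((x^' ∧ y^')^')%ig.

Notation "x ∨ y" := (ig_join x y) (at level 50, left associativity) : ig_scope.

(* Algebras with two binary operations and a constant, subject to no axioms. *)
Record MJAlgebra : Type := MkMJAlgebra {
  mj_carrier :> Type;
  mj_meet : mj_carrier -> mj_carrier -> mj_carrier;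
  mj_join : mj_carrier -> mj_carrier -> mj_carrier;
  mj_zero : mj_carrier
}.

Notation "x ∧ y" := (mj_meet x y) (at level 40, left associativity) : mj_scope.
Notation "x ∨ y" := (mj_join x y) (at level 50, left associativity) : mj_scope.

Definition mj (A : ImplicatorGroupoid) : MJAlgebra :=
  MkMJAlgebra (@ig_meet A) (@ig_join A) (@ig_zero A).

(* Main.v *)
Require Import Defs.

(** The whole theorem rests on three identities for an implicator groupoid:
    [x''] may replace [x] inside [(x -> y) -> z] ([dneg_imp_imp]), [y''] may
    replace [y] inside [(x -> y)'] ([neg_imp_dneg]), and every element of the
    form [(x -> y) -> z] is a fixed point of double negation
    ([dneg_imp_imp_id]).
    A meet [(x -> y')'] has the form [(x -> y') -> 0], so it is a fixed point of
    double negation and depends on [x] and [y] only through [x''] and [y''].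
    The De Morgan laws (a) follow at once; and since negation turns meets into
    joins and conversely, and is injective on the fixed points of double
    negation, each identity in (b) and (c) is the De Morgan dual of its
    partner.

    The three identities are reached in two stages.  With [z = 0], the axiom
    yields [x'' = (0' -> x)''] and [(x -> y)' = ((0' -> x) -> y'')'], so [0' -> x]
    behaves like [x''] under enough negations.  The first stage evaluates the
    constants built from [0] ([0' -> 0' = 0'], [0 -> 0' = 0']) and, with their
    help, strips the outer negations to obtain [0' -> x = x'']
    ([negz_imp_dneg]).  The second stage proves that double negation passes to
    the first argument of an implication, [x'' -> y = (x -> y)'']
    ([dneg_imp_dneg]).  Together with the first replacement law this gives
    [((x -> y) -> z)'' = (x -> y)'' -> z = (x'' -> y) -> z = (x -> y) -> z]. *)

Section Identities.

Local Open Scope ig_scope.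
Local Notation "0" := ig_zero : ig_scope.

(** * Instances of the axioms *)

Lemma imp_impE {A : ImplicatorGroupoid} (x y z : A) :
  (x ~> y) ~> z = ((z^' ~> x) ~> (y ~> z)^')^'.
Proof. exact (ig_I x y z). Qed.

Lemma neg_impE {A : ImplicatorGroupoid} (x z : A) :
  x^' ~> z = ((z^' ~> x) ~> (0 ~> z)^')^'.
Proof. exact (ig_I x 0 z). Qed.

Lemma neg_imp {A : ImplicatorGroupoid} (x y : A) :
  (x ~> y)^' = ((0^' ~> x) ~> y^'^')^'.
Proof. exact (ig_I x y 0). Qed.

Lemma dneg0 {A : ImplicatorGroupoid} : (0 : A)^'^' = 0.
Proof. exact (ig_I0 A). Qed.

Lemma imp_imp_negz {A : ImplicatorGroupoid} (x y : A) :
  (x ~> y) ~> 0^' = ((0 ~> x) ~> (y ~> 0^')^')^'.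
Proof. rewrite imp_impE, dneg0. reflexivity. Qed.

Lemma dneg_negz_imp {A : ImplicatorGroupoid} (x : A) :
  (0^' ~> x)^'^' = x^'^'.
Proof.
symmetry. transitivity (((0^' ~> x) ~> 0^'^')^').
- exact (neg_imp x 0).
- rewrite dneg0. reflexivity.
Qed.

Lemma neg_imp_negz_imp {A : ImplicatorGroupoid} (x y : A) :
  (x ~> (0^' ~> y))^' = (x ~> y)^'.
Proof. rewrite neg_imp, dneg_negz_imp, <- neg_imp. reflexivity. Qed.

(** * Constants *)

Lemma neg_negz_imp_imp_negz {A : ImplicatorGroupoid} (x : A) :
  ((0^' ~> x) ~> 0^')^' = (x ~> 0^')^'.
Proof. rewrite (neg_imp x), dneg0. reflexivity. Qed.

Lemma tneg_imp_negz {A : ImplicatorGroupoid} (x : A) :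
  (x ~> 0^')^'^'^' = ((0 ~> x) ~> 0^')^'.
Proof.
rewrite <- (dneg_negz_imp (x ~> 0^')^').
apply (f_equal (@ig_neg A)). symmetry. exact (imp_imp_negz 0 x).
Qed.

Lemma neg_z_imp_negz_imp_negz {A : ImplicatorGroupoid} :
  (((0 : A) ~> 0^') ~> 0^')^' = 0.
Proof.
rewrite <- (tneg_imp_negz 0^'), dneg_negz_imp, dneg0. exact dneg0.
Qed.

Lemma imp_z_imp_negz_imp_negz {A : ImplicatorGroupoid} (x : A) :
  (x ~> (0 ~> 0^')) ~> 0^' = (0 ~> x)^'^'.
Proof. rewrite imp_imp_negz, neg_z_imp_negz_imp_negz. reflexivity. Qed.

(** Both sides are values of [((0' -> (0 -> 0')) -> 0')']: its inner [0' ->] can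
    be dropped, or the expression can be read as [(0 -> 0')''']. *)
Lemma neg_negz_imp_negz {A : ImplicatorGroupoid} :
  ((0 : A)^' ~> 0^')^' = 0.
Proof.
pose proof (neg_negz_imp_imp_negz (0 ~> (0 : A)^')) as H.
rewrite imp_z_imp_negz_imp_negz, neg_z_imp_negz_imp_negz in H.
rewrite tneg_imp_negz in H. exact H.
Qed.

Lemma imp_negz_imp_negz {A : ImplicatorGroupoid} (x : A) :
  (x ~> 0^') ~> 0^' = (0 ~> x)^'^'.
Proof. rewrite imp_imp_negz, neg_negz_imp_negz. reflexivity. Qed.

Lemma dneg_z_imp_imp_negz {A : ImplicatorGroupoid} (x : A) :
  (0 ~> (x ~> 0^'))^'^' = (0 ~> x)^'^' ~> 0^'.
Proof. rewrite <- !imp_negz_imp_negz. reflexivity. Qed.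

(** Implication into [0 -> 0'] and implication into [0'] agree after one more
    implication into [0'], so [(0 -> -)''] sees no difference between them;
    inserting [0' ->], which negations absorb, links the two sides. *)
Lemma dneg_z_imp_negz {A : ImplicatorGroupoid} :
  ((0 : A) ~> 0^')^'^' = 0^' ~> 0^'.
Proof.
assert (Ha : ((0 : A) ~> 0^')^'^' ~> 0^' = (0 ~> 0^')^'^').
{ rewrite <- dneg_z_imp_imp_negz, neg_imp_negz_imp. reflexivity. }
assert (Hb : ((0 : A) ~> (0 ~> 0^'))^'^' = (0 ~> 0^')^'^' ~> 0^').
{ rewrite <- (neg_imp_negz_imp 0 (0 ~> 0^')), <- imp_negz_imp_negz,
    imp_z_imp_negz_imp_negz. reflexivity. }
rewrite <- Ha, <- Hb, dneg_z_imp_imp_negz.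
change ((0 : A) ~> 0) with (0 : A)^'. rewrite dneg0. reflexivity.
Qed.

Lemma neg_imp_z_imp_negz {A : ImplicatorGroupoid} (x : A) :
  (x ~> (0 ~> 0^'))^' = (x ~> 0^')^'.
Proof.
rewrite neg_imp, dneg_z_imp_negz, neg_imp_negz_imp, neg_negz_imp_imp_negz.
reflexivity.
Qed.

Lemma negz_imp_negz {A : ImplicatorGroupoid} : (0 : A)^' ~> 0^' = 0^'.
Proof.
rewrite <- dneg_z_imp_negz, <- dneg_negz_imp, neg_imp_z_imp_negz,
  neg_negz_imp_negz.
reflexivity.
Qed.

(** * Double negation and implication from [0'] *)

Lemma neg_negz_imp_dneg {A : ImplicatorGroupoid} (x : A) :
  (0^' ~> x^'^')^' = (0^' ~> x)^'.
Proof. rewrite (neg_imp 0^' x), negz_imp_negz. reflexivity. Qed.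

Lemma dneg_dneg {A : ImplicatorGroupoid} (x : A) : x^'^'^'^' = x^'^'.
Proof.
rewrite <- (dneg_negz_imp x^'^'), neg_negz_imp_dneg. exact (dneg_negz_imp x).
Qed.

Lemma neg_imp_dneg {A : ImplicatorGroupoid} (x y : A) :
  (x ~> y^'^')^' = (x ~> y)^'.
Proof. rewrite neg_imp, dneg_dneg, <- neg_imp. reflexivity. Qed.

Lemma neg_negz_imp_imp {A : ImplicatorGroupoid} (x y : A) :
  ((0^' ~> x) ~> y)^' = (x ~> y)^'.
Proof. rewrite <- neg_imp_dneg, <- neg_imp. reflexivity. Qed.

Lemma imp_negz_imp_imp {A : ImplicatorGroupoid} (x y z : A) :
  (x ~> (0^' ~> y)) ~> z = (x ~> y) ~> z.
Proof. rewrite imp_impE, neg_negz_imp_imp, <- imp_impE. reflexivity. Qed.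

Lemma negz_imp_imp_imp {A : ImplicatorGroupoid} (x y z : A) :
  ((0^' ~> x) ~> y) ~> z = (x ~> y) ~> z.
Proof. rewrite imp_impE, imp_negz_imp_imp, <- imp_impE. reflexivity. Qed.

Lemma neg_negz_imp_imp_id {A : ImplicatorGroupoid} (x z : A) :
  (0^' ~> x)^' ~> z = x^' ~> z.
Proof. exact (negz_imp_imp_imp x 0 z). Qed.

Lemma tneg_imp {A : ImplicatorGroupoid} (x y : A) : x^'^'^' ~> y = x^' ~> y.
Proof.
rewrite <- (neg_negz_imp_imp_id x^'^'), neg_negz_imp_dneg.
exact (neg_negz_imp_imp_id x y).
Qed.

Lemma imp_negz_impE {A : ImplicatorGroupoid} (x y : A) :
  (x ~> 0^') ~> y = ((y^' ~> x) ~> y^')^'.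
Proof.
rewrite imp_impE, <- neg_imp_dneg.
(* Doubling the negation of [0' -> y] exposes [(0' -> y)''], which is [y'']. *)
rewrite dneg_negz_imp, neg_imp_dneg. reflexivity.
Qed.

Lemma z_imp_negz_imp_neg {A : ImplicatorGroupoid} (x : A) :
  (0 ~> 0^') ~> x^' = (x^' ~> x)^'.
Proof.
rewrite imp_negz_impE, neg_imp_dneg.
exact (f_equal (@ig_neg A) (tneg_imp x x)).
Qed.

Lemma neg_imp_negz {A : ImplicatorGroupoid} (x : A) :
  x^' ~> 0^' = (0 ~> x)^'^'.
Proof.
rewrite neg_impE, dneg0, <- neg_imp_dneg, dneg_z_imp_negz, negz_imp_negz, dneg0.
reflexivity.
Qed.

Lemma z_imp_negz {A : ImplicatorGroupoid} : (0 : A) ~> 0^' = 0^'.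
Proof.
transitivity ((0 : A)^'^' ~> 0^').
- rewrite dneg0. reflexivity.
- rewrite neg_imp_negz, dneg_z_imp_negz. exact negz_imp_negz.
Qed.

Lemma neg_neg_imp_self {A : ImplicatorGroupoid} (x : A) :
  (x^' ~> x)^' = 0^' ~> x^'.
Proof. rewrite <- z_imp_negz_imp_neg, z_imp_negz. reflexivity. Qed.

Lemma neg_dneg_imp_neg {A : ImplicatorGroupoid} (x : A) :
  (x^'^' ~> x^')^' = 0^' ~> x.
Proof.
transitivity ((0 ~> 0^') ~> x).
- symmetry. exact (imp_negz_impE 0 x).
- rewrite z_imp_negz. reflexivity.
Qed.

(** A premise [0' ->] on [x] has no effect here, and [0' -> x''] equals [0' -> x]
    since both are [(x'' -> x')']. *)
Lemma dneg_imp_imp {A : ImplicatorGroupoid} (x y z : A) :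
  (x^'^' ~> y) ~> z = (x ~> y) ~> z.
Proof.
rewrite <- negz_imp_imp_imp, <- neg_neg_imp_self, neg_dneg_imp_neg.
exact (negz_imp_imp_imp x y z).
Qed.

Lemma neg_dneg_imp {A : ImplicatorGroupoid} (x y : A) :
  (x^'^' ~> y)^' = (x ~> y)^'.
Proof. exact (dneg_imp_imp x y 0). Qed.

Lemma neg_imp_neg_self {A : ImplicatorGroupoid} (x : A) :
  (x ~> x^')^' = 0^' ~> x.
Proof. rewrite <- neg_dneg_imp. exact (neg_dneg_imp_neg x). Qed.

Lemma z_imp_impE {A : ImplicatorGroupoid} (x y : A) :
  (0 ~> y) ~> x = (x ~> (y ~> x)^')^'.
Proof. rewrite imp_impE. exact (neg_dneg_imp x (y ~> x)^'). Qed.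

Lemma z_imp_neg_imp_self {A : ImplicatorGroupoid} (x : A) :
  (0 ~> x^') ~> x = 0^' ~> x.
Proof.
rewrite z_imp_impE, neg_neg_imp_self, neg_imp_negz_imp.
exact (neg_imp_neg_self x).
Qed.

Lemma negz_impE {A : ImplicatorGroupoid} (x : A) :
  0^' ~> x = ((0 ~> x) ~> x^')^'.
Proof.
transitivity ((0^' ~> 0^') ~> x).
- rewrite negz_imp_negz. reflexivity.
- rewrite imp_negz_impE, neg_imp_negz. exact (neg_dneg_imp (0 ~> x) x^').
Qed.

Lemma negz_imp_neg {A : ImplicatorGroupoid} (x : A) :
  0^' ~> x^' = (0^' ~> x)^'.
Proof.
rewrite negz_impE, neg_imp_dneg, z_imp_neg_imp_self. reflexivity.
Qed.

(** [0' ->] commutes with negation.  In [(0' -> x')'] the inner negation can thus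
    be pulled out, giving [(0' -> x)''], which is [x''], or the outer one pushed
    in, giving [0' -> x'']; like [0' -> x], the latter is [(x'' -> x')']. *)
Lemma negz_imp_dneg {A : ImplicatorGroupoid} (x : A) : 0^' ~> x = x^'^'.
Proof.
transitivity ((0^' ~> x^')^').
- rewrite <- negz_imp_neg, <- neg_neg_imp_self, neg_dneg_imp_neg. reflexivity.
- rewrite negz_imp_neg. exact (dneg_negz_imp x).
Qed.

(** * Double negation of an implication *)

Lemma neg_imp_neg_self_dneg {A : ImplicatorGroupoid} (x : A) :
  (x ~> x^')^' = x^'^'.
Proof. rewrite neg_imp_neg_self. exact (negz_imp_dneg x). Qed.

(** In the expansion [((x' -> x) -> (y -> x)')'] of the left-hand side, [x' -> x]
    acts as [x], because the two have the same double negation. *)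
Lemma imp_imp_self {A : ImplicatorGroupoid} (x y : A) :
  (x ~> y) ~> x = (0 ~> y) ~> x.
Proof.
rewrite (imp_impE x), z_imp_impE, <- neg_dneg_imp, neg_neg_imp_self,
  negz_imp_dneg, !neg_dneg_imp.
reflexivity.
Qed.

Lemma imp_negz_imp {A : ImplicatorGroupoid} (x y : A) :
  (x ~> 0^') ~> y = ((0 ~> x) ~> y^')^'.
Proof. rewrite imp_negz_impE, imp_imp_self. reflexivity. Qed.

Lemma imp_negz_imp_neg {A : ImplicatorGroupoid} (x y : A) :
  (x ~> 0^') ~> y^' = ((0 ~> x) ~> y)^'.
Proof. rewrite imp_negz_imp. exact (neg_imp_dneg (0 ~> x) y). Qed.

Lemma dneg_impE {A : ImplicatorGroupoid} (x y : A) :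
  x^'^' ~> y = ((y^' ~> 0^') ~> (x ~> y)^')^'.
Proof. rewrite <- negz_imp_dneg. exact (imp_impE 0^' x y). Qed.

(** With [u = 0 -> x], both sides equal [(u -> u')']: the left one as for any
    [u], the right one by expanding [0 -> x = 0'' -> x], where [x' -> 0'] is
    [u'']. *)
Lemma dneg_z_imp {A : ImplicatorGroupoid} (x : A) : (0 ~> x)^'^' = 0 ~> x.
Proof.
rewrite <- neg_imp_neg_self_dneg, <- neg_dneg_imp, <- neg_imp_negz, <- dneg_impE,
  dneg0.
reflexivity.
Qed.

Lemma dneg_imp_alt {A : ImplicatorGroupoid} (x y : A) :
  x^'^' ~> y = (y ~> 0^') ~> (x ~> y).
Proof.
rewrite dneg_impE, neg_imp_negz, neg_dneg_imp, <- imp_negz_imp. reflexivity.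
Qed.

(** The right-hand side of [dneg_imp_alt] reappears, doubly negated, when the
    negation of [x -> y] in [dneg_impE] is pulled out. *)
Lemma dneg_imp_dneg {A : ImplicatorGroupoid} (x y : A) :
  x^'^' ~> y = (x ~> y)^'^'.
Proof.
rewrite dneg_impE, imp_negz_imp_neg.
assert (H : 0 ~> y^' = y^'^' ~> 0^').
{ rewrite neg_imp_negz, dneg_z_imp. reflexivity. }
rewrite H, dneg_imp_imp, <- dneg_imp_alt, neg_dneg_imp. reflexivity.
Qed.

Lemma dneg_imp_imp_id {A : ImplicatorGroupoid} (x y z : A) :
  ((x ~> y) ~> z)^'^' = (x ~> y) ~> z.
Proof. rewrite <- !dneg_imp_dneg. exact (dneg_imp_imp x y z). Qed.

(** * De Morgan laws *)

Lemma dneg_meet {A : ImplicatorGroupoid} (x y : A) : (x ∧ y)^'^' = x ∧ y.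
Proof. exact (dneg_imp_imp_id x y^' 0). Qed.

Lemma dneg_join {A : ImplicatorGroupoid} (x y : A) : (x ∨ y)^'^' = x ∨ y.
Proof. exact (f_equal (@ig_neg A) (dneg_meet x^' y^')). Qed.

Lemma meet_dneg {A : ImplicatorGroupoid} (x y : A) : x^'^' ∧ y^'^' = x ∧ y.
Proof.
unfold ig_meet. rewrite neg_imp_dneg. exact (neg_dneg_imp x y^').
Qed.

Lemma neg_join {A : ImplicatorGroupoid} (x y : A) : (x ∨ y)^' = x^' ∧ y^'.
Proof. exact (dneg_meet x^' y^'). Qed.

Lemma neg_meet {A : ImplicatorGroupoid} (x y : A) : (x ∧ y)^' = x^' ∨ y^'.
Proof. unfold ig_join. rewrite meet_dneg. reflexivity. Qed.

(** * Commutativity and distributivity *)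

Lemma meet_comm_iff_join_comm (A : ImplicatorGroupoid) :
  (forall x y : A, x ∧ y = y ∧ x) <-> (forall x y : A, x ∨ y = y ∨ x).
Proof.
split; intros H x y.
- unfold ig_join. rewrite (H x^'). reflexivity.
- rewrite <- (dneg_meet x y), <- (dneg_meet y x), !neg_meet, (H x^').
  reflexivity.
Qed.

Lemma meet_joinr_iff_join_meetr (A : ImplicatorGroupoid) :
  (forall x y z : A, x ∧ (y ∨ z) = (x ∧ y) ∨ (x ∧ z)) <->
  (forall x y z : A, x ∨ (y ∧ z) = (x ∨ y) ∧ (x ∨ z)).
Proof.
split; intros H x y z.
- rewrite <- (dneg_join x), <- (dneg_meet (x ∨ y)). apply f_equal.
  rewrite neg_join, !neg_meet, H, !neg_join. reflexivity.
- rewrite <- (dneg_meet x (y ∨ z)), <- (dneg_join (x ∧ y)). apply f_equal.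
  rewrite neg_meet, !neg_join, H, !neg_meet. reflexivity.
Qed.

End Identities.

Theorem theorem7p1 (A : ImplicatorGroupoid) :
  ((forall x y : A, ((x ∨ y)^' = x^' ∧ y^')%ig) /\
   (forall x y : A, ((x ∧ y)^' = x^' ∨ y^')%ig)) /\
  ((forall x y : mj A, (x ∧ y = y ∧ x)%mj) <->
   (forall x y : mj A, (x ∨ y = y ∨ x)%mj)) /\
  ((forall x y z : mj A, (x ∧ (y ∨ z) = (x ∧ y) ∨ (x ∧ z))%mj) <->
   (forall x y z : mj A, (x ∨ (y ∧ z) = (x ∨ y) ∧ (x ∨ z))%mj)).
Proof.
split; [split | split].
- exact neg_join.
- exact neg_meet.
- exact (meet_comm_iff_join_comm A).
- exact (meet_joinr_iff_join_meetr A).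
Qed.
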